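(* Let $a(h)$ be a real-valued function of the mesh size $h$ such that $$\inf_{h>0}\frac{a(h)}{h}>0.$$ For any $T>0$ there exists a positive constant $C(T)$ such that $$\|\mathbf{u}^h\|_{L^4(0,T;L^4(\mathbb{T}_h))}\le C(T)\,\|\mathbf{u}^h(0)\|_{L^2(\mathbb{T}_h)}$$ holds for all $\mathbf{u}^h(0)\in L^2(\mathbb{T}_h)$, uniformly in $h>0$ (i.e. $C(T)$ does not depend on $h$), where $\mathbf{u}^h$ is the solution with initial datum $\mathbf{u}^h(0)$ of the viscous semidiscrete scheme $$i\frac{du^h_j}{dt}+\frac{u^h_{j+1}-2u^h_j+u^h_{j-1}}{h^2}=i\,a(h)\,\frac{u^h_{j+1}-2u^h_j+u^h_{j-1}}{h^2},\quad t>0,\ j=0,\dots,N,$$ with the periodicity conventions $u^h_{-1}=u^h_N$ and $u^h_{N+1}=u^h_0$. Here $h$ ranges over the mesh sizes $h=1/(N+1)$ with $N$ an even positive integer.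
   Context: $N$ denotes an even positive integer and $h=1/(N+1)$ is the mesh size; thus $h$ always ranges over the values $1/(N+1)$, $N$ even positive. For $1\le p<\infty$, $L^p(\mathbb{T}_h)$ is the space of complex vectors $\mathbf{u}=(u_0,\dots,u_N)$ endowed with the norm $\|\mathbf{u}\|_{L^p(\mathbb{T}_h)}^p=h\sum_{j=0}^N|u_j|^p$. For a time-dependent vector $\mathbf{u}^h(t)=(u^h_j(t))_{j=0}^N$, $\|\mathbf{u}^h\|_{L^4(0,T;L^4(\mathbb{T}_h))}=\big(\int_0^T\|\mathbf{u}^h(t)\|_{L^4(\mathbb{T}_h)}^4\,dt\big)^{1/4}$. *)

(* Defs.v *)
From HB Require Import structures.
From mathcomp Require Import all_boot all_order all_algebra.
From mathcomp Require Import complex.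
From mathcomp Require Import all_classical all_reals all_analysis.

Set Implicit Arguments.
Unset Strict Implicit.
Unset Printing Implicit Defensive.

Import Order.TTheory GRing.Theory Num.Theory.
Import numFieldNormedType.Exports.

Local Open Scope classical_set_scope.
Local Open Scope ring_scope.
Local Open Scope complex_scope.

Definition admissible (N : nat) : bool := (0 < N)%N && ~~ odd N.

Definition mesh (R : realType) (N : nat) : R := N.+1%:R^-1.

Definition mesh_sizes (R : realType) : set R :=
  [set mesh R N | N in [set N | admissible N]].

Arguments mesh_sizes R : clear implicits.

(* [Normc.normc] is the real-valued modulus; [`|z|] would have type [R[i]]. *)
Definition Lp_Th (R : realType) (p : R) (N : nat) (u : 'rV[R[i]]_N.+1) : R :=
  (mesh R N * \sum_(j < N.+1) Normc.normc (u 0 j) `^ p) `^ p^-1.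

(* Extended-real valued: equal to [+oo] when the integral diverges. *)
Definition L4L4_Th (R : realType) (T : R) (N : nat)
    (u : R -> 'rV[R[i]]_N.+1) : \bar R :=
  ((\int[lebesgue_measure]_(t in `[0%R, T]) (Lp_Th 4 (u t) `^ 4)%:E)
     `^ (4^-1))%E.

(* [ordS] and [ord_pred] are the cyclic successor and predecessor on ['I_N.+1],
   which encode the conventions u_{N+1} = u_0 and u_{-1} = u_N. *)
Definition discrete_laplacian (R : realType) (N : nat)
    (u : 'rV[R[i]]_N.+1) (j : 'I_N.+1) : R[i] :=
  (u 0 (ordS j) - 2 * u 0 j + u 0 (ord_pred j)) / ((mesh R N)%:C ^+ 2).

(* [R[i]] carries no normed-module structure over [R], so derivatives and
   limits of complex-valued functions of a real variable are componentwise. *)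
Definition is_cderive (R : realType) (f : R -> R[i]) (t : R) (df : R[i]) : Prop :=
  is_derive t 1 (fun s => complex.Re (f s)) (complex.Re df) /\
  is_derive t 1 (fun s => complex.Im (f s)) (complex.Im df).

Definition right_continuous_at (R : realType) (f : R -> R[i]) (t : R) : Prop :=
  complex.Re (f s) @[s --> t^'+] --> complex.Re (f t) /\
  complex.Im (f s) @[s --> t^'+] --> complex.Im (f t).

(* Only the values of [u] at times [t >= 0] matter. *)
Definition viscous_solution (R : realType) (a : R -> R) (N : nat)
    (phi : 'rV[R[i]]_N.+1) (u : R -> 'rV[R[i]]_N.+1) : Prop :=
  [/\ u 0 = phi,
      forall j : 'I_N.+1, right_continuous_at (fun t => u t 0 j) 0 &
      forall (t : R) (j : 'I_N.+1), 0 < t ->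
        exists2 du : R[i], is_cderive (fun s => u s 0 j) t du &
          'i%C * du + discrete_laplacian (u t) j =
          'i%C * (a (mesh R N))%:C * discrete_laplacian (u t) j].

(* Main.v *)
Require Import Defs.
From HB Require Import structures.
From mathcomp Require Import all_boot all_order all_algebra.
From mathcomp Require Import complex.
From mathcomp Require Import all_classical all_reals all_analysis.
From mathcomp Require Import ring lra zify.

(** The discrete Fourier transform turns the scheme into the uncoupled equations
    [w_k' = - (a + i) lambda_k w_k], with
    [lambda_k = (2 - 2 cos (k theta)) / h^2] and [theta = 2 pi h]. Without
    viscosity, a space-time L4 estimate uniform in [h] fails because
    [lambda_k] loses its convexity when [k theta] approaches [pi / 2]. The idea
    is to use the dispersion only for the frequencies with [k theta] at most
    [1 / 2] in absolute value, and the dissipation for all the others.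

    For high frequencies, [lambda_k] is of order [h^-2], so the assumption
    [a >= c h] damps them at a rate of order [1 / h]. That pays exactly for the
    factor [1 / h] lost in the trivial comparison of the L4 and L2 norms on the
    grid ([high_band_bound]).

    For low frequencies, the argument is the one of Zygmund for the torus. The
    fourth power of the L4 norm is a sum over the quadruples with
    [k1 + k2 = l1 + l2] of products of four modes. Each product [w] solves
    [w' = - z w], where the imaginary part of [z] is
    [lambda_k1 + lambda_k2 - lambda_l1 - lambda_l2], hence at least
    [|k1 - l1| |k2 - l1|] in absolute value ([dispersion_gap]). Either the
    quadruple is trivial ([l1 = k1] or [l1 = k2]) and its contribution over
    [[0, T]] is at most [T] times the initial size, or [- w / z] is a primitive
    of [w] and the contribution is at most twice the initial size divided by
    [|z|]; the nonnegative real part of [z], which comes from the viscosity of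
    arbitrary size, can only help ([quadruple_bound]). The sum of all
    contributions is controlled by the Schur test ([low_band_bound]). Small
    positive and small negative frequencies are handled separately, so that
    sums of two frequencies never wrap around modulo [N + 1].

    Neither the solution nor its L4 norm is ever integrated explicitly. All the
    time estimates are expressed by functions whose derivative dominates the
    quantity to be integrated ([increment_bound]), and these are converted into
    one bound of a Lebesgue integral at the end ([integral_le_increment]). *)

Set Implicit Arguments.
Unset Strict Implicit.
Unset Printing Implicit Defensive.

Import Order.TTheory GRing.Theory Num.Theory.
Import numFieldNormedType.Exports.

Local Open Scope classical_set_scope.
Local Open Scope ring_scope.
Local Open Scope complex_scope.

(** * Bounding integrals by increments *)

(** The regularity on the half-line that a solution of the scheme has: an
    initial value attained from the right and a derivative afterwards. *)
Definition regular (R : realType) (f : R -> R) : Prop :=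
  f s @[s --> 0^'+] --> f 0 /\ forall t, 0 < t -> derivable f t 1.

Lemma regular_within (R : realType) (f : R -> R) (T : R) :
  0 < T -> regular f -> {within `[0, T], continuous f}.
Proof.
move=> T0 [f0 df]; have cf t : 0 < t -> {for t, continuous f}.
  by move=> t0; apply: differentiable_continuous; exact/derivable1_diffP/df.
apply/continuous_within_itvP => //; split=> //.
  by move=> t /[!in_itv]/= /andP[t0 _]; exact: cf.
exact/cvg_at_left_filter/cf.
Qed.

Lemma regularM (R : realType) (f g : R -> R) :
  regular f -> regular g -> regular (fun t => f t * g t).
Proof.
move=> [f0 df] [g0 dg]; split; first exact: cvgM.
by move=> t t0; apply: derivableM; [exact: df|exact: dg].
Qed.

Lemma regularD (R : realType) (f g : R -> R) :
  regular f -> regular g -> regular (fun t => f t + g t).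
Proof.
move=> [f0 df] [g0 dg]; split; first exact: cvgD.
by move=> t t0; apply: derivableD; [exact: df|exact: dg].
Qed.

Lemma regular_cst (R : realType) (k : R) : regular (fun=> k).
Proof. by split=> [|t _]; [exact: cvg_cst|exact: derivable_cst]. Qed.

Lemma regular_sum (R : realType) (I : Type) (s : seq I) (f : I -> R -> R) :
  (forall i, regular (f i)) -> regular (fun t => \sum_(i <- s) f i t).
Proof.
move=> rf; elim: s => [|i s ih].
  have -> : (fun t => \sum_(i <- [::]) f i t) = fun=> 0.
    by apply/funext => t; rewrite big_nil.
  exact: regular_cst.
have -> : (fun t => \sum_(j <- i :: s) f j t) =
    (fun t => f i t + \sum_(j <- s) f j t).
  by apply/funext => t; rewrite big_cons.
exact: regularD.
Qed.

(** The only place where an integral is handled: the difference between [F] and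
    the primitive of [f] has a nonnegative derivative, so that the mean value
    theorem orders its values at [0] and [T]. *)
Lemma integral_le_increment (R : realType) (f F : R -> R) (T : R) :
  0 < T -> regular f -> F s @[s --> 0^'+] --> F 0 ->
  (forall t : R, 0 < t -> exists2 d, is_derive t 1 F d & f t <= d) ->
  (\int[lebesgue_measure]_(t in `[0%R, T]) (f t)%:E <= (F T - F 0)%:E)%E.
Proof.
move=> T0 rf F0 dF.
have rF : regular F by split=> // t /dF[d []].
have cf := regular_within T0 rf; have cF := regular_within T0 rF.
have intf : (@lebesgue_measure R).-integrable `[0%R, T] (EFin \o f).
  by apply: continuous_compact_integrable => //; exact: segment_compact.
pose G x := parameterized_integral lebesgue_measure 0 x f.
have cG : {within `[0, T], continuous G}.
  by apply: parameterized_integral_continuous => //; exact: ltW.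
have dG (x : R) : x \in `]0, T[ -> derivable G x 1 /\ derive1 G x = f x.
  move=> xT; have /[!in_itv]/= /andP[x0 xltT] := xT.
  apply: (continuous_FTC1_closed xltT) => //.
  exact: (within_continuous_continuous T0 cf).
have dD (x : R) : x \in `]0, T[ ->
    is_derive x 1 (F - G) (derive1 F x - derive1 G x).
  move=> xT; have /[!in_itv]/= /andP[x0 _] := xT.
  apply: is_deriveB; rewrite derive1E; apply: derivableP.
    by case: rF => _; apply.
  by case: (dG x xT).
have cD : {within `[0, T], continuous (F - G)}.
  move=> x; apply: continuousD _; first exact: cF.
  by apply: continuousN; exact: cG.
have [c cT e] := MVT T0 dD cD.
have /[!in_itv]/= /andP[c0 _] := cT.
have {e} : (F - G) 0 <= (F - G) T.
  rewrite -subr_ge0 e mulr_ge0 ?subr_ge0 ?(ltW T0)//.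
  have [d dFd fd] := dF c c0.
  by rewrite (dG c cT).2 derive1E derive_val.
rewrite !fctE => h.
have -> : (\int[lebesgue_measure]_(t in `[0%R, T]) (f t)%:E)%E = (G T)%:E.
  rewrite /G /parameterized_integral /Rintegral fineK//.
  exact: integrable_fin_num.
have G0 : G 0 = 0.
  by rewrite /G /parameterized_integral set_itv1 Rintegral_set1.
by rewrite lee_fin; rewrite G0 in h; lra.
Qed.

(** A certificate for [\int_0^T f <= B] in the form of an explicit function
    whose derivative dominates [f]. Unlike the integral, it adds up, scales and
    passes to larger functions without any measurability or integrability
    condition, and it can be built from the differential equation alone. *)
Definition increment_bound (R : realType) (T : R) (f : R -> R) (B : R) : Prop :=
  exists F : R -> R, [/\ F s @[s --> 0^'+] --> F 0,
    forall t : R, 0 < t -> exists2 d, is_derive t 1 F d & f t <= d &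
    F T - F 0 <= B].

Lemma increment_boundD (R : realType) (T : R) (f g : R -> R) (A B : R) :
  increment_bound T f A -> increment_bound T g B ->
  increment_bound T (fun t => f t + g t) (A + B).
Proof.
move=> [F [F0 dF FA]] [G [G0 dG GB]]; exists (F + G); split.
- exact: cvgD.
- move=> t t0; have [d ? ?] := dF t t0; have [e ? ?] := dG t t0.
  by exists (d + e); [exact: is_deriveD|exact: lerD].
- by rewrite !fctE; lra.
Qed.

Lemma increment_boundZ (R : realType) (T k : R) (f : R -> R) (A : R) :
  0 <= k -> increment_bound T f A ->
  increment_bound T (fun t => k * f t) (k * A).
Proof.
move=> k0 [F [F0 dF FA]]; exists (k \*: F); split.
- by apply: cvgZr.
- move=> t t0; have [d ? ?] := dF t t0.
  by exists (k *: d); [exact: is_deriveZ|exact: ler_wpM2l].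
- by rewrite /= -scalerBr; exact: ler_wpM2l.
Qed.

Lemma increment_bound_le (R : realType) (T : R) (f g : R -> R) (A B : R) :
  (forall t : R, 0 < t -> f t <= g t) -> A <= B ->
  increment_bound T g A -> increment_bound T f B.
Proof.
move=> fg AB [F [F0 dF FA]]; exists F; split=> //; last exact: le_trans AB.
move=> t t0; have [d ? gd] := dF t t0.
by exists d => //; apply: le_trans gd; exact: fg.
Qed.

Lemma increment_bound_cst (R : realType) (T A : R) :
  increment_bound T (fun=> A) (T * A).
Proof.
exists (A \*: id); split.
- by apply: cvgZr; apply: cvg_at_right_filter; exact: cvg_id.
- by move=> t _; exists (A *: 1); [exact: is_deriveZ|rewrite /GRing.scale/= mulr1].
- by rewrite /= scaler0 subr0 /GRing.scale/= mulrC.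
Qed.

Lemma increment_bound_sum (R : realType) (T : R) (I : Type) (s : seq I)
    (P : pred I) (f : I -> R -> R) (B : I -> R) :
  (forall i, P i -> increment_bound T (f i) (B i)) ->
  increment_bound T (fun t => \sum_(i <- s | P i) f i t)
    (\sum_(i <- s | P i) B i).
Proof.
move=> h; elim: s => [|i s ih].
  apply: increment_bound_le (increment_bound_cst T 0); last first.
    by rewrite big_nil mulr0.
  by move=> t _; rewrite big_nil.
rewrite big_cons; case: ifP => Pi; last first.
  by apply: increment_bound_le ih => // t _; rewrite big_cons Pi.
apply: increment_bound_le (increment_boundD (h i Pi) ih) => // t _.
by rewrite big_cons Pi.
Qed.

(** * Modes *)

(** The solutions of [f' = c f] on the positive half-line. Products and
    conjugates of such functions are again of this kind, which is what makes the
    quartic expression of the L4 norm tractable without solving the equation. *)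
Definition linear_mode (R : realType) (c : R[i]) (f : R -> R[i]) : Prop :=
  right_continuous_at f 0 /\ forall t : R, 0 < t -> is_cderive f t (c * f t).

Lemma ReM (R : realType) (x y : R[i]) :
  complex.Re (x * y) =
  complex.Re x * complex.Re y - complex.Im x * complex.Im y.
Proof. by case: x; case: y. Qed.

Lemma ImM (R : realType) (x y : R[i]) :
  complex.Im (x * y) =
  complex.Re x * complex.Im y + complex.Im x * complex.Re y.
Proof. by case: x; case: y. Qed.

Lemma ReD (R : realType) (x y : R[i]) :
  complex.Re (x + y) = complex.Re x + complex.Re y.
Proof. by case: x; case: y. Qed.

Lemma ImD (R : realType) (x y : R[i]) :
  complex.Im (x + y) = complex.Im x + complex.Im y.
Proof. by case: x; case: y. Qed.

Lemma Re_sum (R : realType) (I : Type) (s : seq I) (P : pred I) (F : I -> R[i]) :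
  complex.Re (\sum_(i <- s | P i) F i) = \sum_(i <- s | P i) complex.Re (F i).
Proof. by apply: (big_morph (@complex.Re R)) => // x y; exact: ReD. Qed.

Lemma conjc_Im (R : realType) (z : R[i]) : complex.Im (conjc z) = - complex.Im z.
Proof. by case: z. Qed.

Lemma conjc_Re (R : realType) (z : R[i]) : complex.Re (conjc z) = complex.Re z.
Proof. by case: z. Qed.

Lemma normc_conj (R : realType) (z : R[i]) :
  Normc.normc (conjc z) = Normc.normc z.
Proof. by case: z => a b; rewrite /= sqrrN. Qed.

Lemma complexP (R : realType) (x y : R[i]) :
  complex.Re x = complex.Re y -> complex.Im x = complex.Im y -> x = y.
Proof. by case: x y => a b [c d] /= -> ->. Qed.

Lemma right_continuousM (R : realType) (f g : R -> R[i]) (t : R) :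
  right_continuous_at f t -> right_continuous_at g t ->
  right_continuous_at (fun s => f s * g s) t.
Proof.
move=> [rf jf] [rg jg]; split.
  under eq_fun do rewrite ReM; rewrite ReM.
  by apply: cvgB; apply: cvgM.
under eq_fun do rewrite ImM; rewrite ImM.
by apply: cvgD; apply: cvgM.
Qed.

Lemma right_continuousD (R : realType) (f g : R -> R[i]) (t : R) :
  right_continuous_at f t -> right_continuous_at g t ->
  right_continuous_at (fun s => f s + g s) t.
Proof.
move=> [rf jf] [rg jg]; split.
  by under eq_fun do rewrite ReD; rewrite ReD; apply: cvgD.
by under eq_fun do rewrite ImD; rewrite ImD; apply: cvgD.
Qed.

Lemma right_continuous_cst (R : realType) (c : R[i]) (t : R) :
  right_continuous_at (fun=> c) t.
Proof. by split; exact: cvg_cst. Qed.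

Lemma is_cderiveD (R : realType) (f g : R -> R[i]) (t : R) (df dg : R[i]) :
  is_cderive f t df -> is_cderive g t dg ->
  is_cderive (fun s => f s + g s) t (df + dg).
Proof.
move=> [rf jf] [rg jg]; split.
  by under eq_fun do rewrite ReD; rewrite ReD; exact: is_deriveD.
by under eq_fun do rewrite ImD; rewrite ImD; exact: is_deriveD.
Qed.

Lemma is_cderiveM (R : realType) (f g : R -> R[i]) (t : R) (df dg : R[i]) :
  is_cderive f t df -> is_cderive g t dg ->
  is_cderive (fun s => f s * g s) t (df * g t + f t * dg).
Proof.
move=> [rf jf] [rg jg]; split.
  under eq_fun do rewrite ReM.
  apply: (is_derive_eq (is_deriveB (is_deriveM rf rg) (is_deriveM jf jg))).
  by rewrite ReD !ReM /GRing.scale/=; ring.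
under eq_fun do rewrite ImM.
apply: (is_derive_eq (is_deriveD (is_deriveM rf jg) (is_deriveM jf rg))).
by rewrite ImD !ImM /GRing.scale/=; ring.
Qed.

Lemma is_cderive_cst (R : realType) (c : R[i]) (t : R) :
  is_cderive (fun=> c) t 0.
Proof. by split; exact: is_derive_cst. Qed.

Lemma is_cderive_sum (R : realType) (I : Type) (s : seq I) (P : pred I)
    (f : I -> R -> R[i]) (t : R) (df : I -> R[i]) :
  (forall i, P i -> is_cderive (f i) t (df i)) ->
  is_cderive (fun s' => \sum_(i <- s | P i) f i s') t (\sum_(i <- s | P i) df i).
Proof.
move=> h; elim: s => [|i s ih].
  rewrite big_nil; have -> : (fun t => \sum_(i <- [::] | P i) f i t) = fun=> 0.
    by apply/funext => t'; rewrite big_nil.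
  exact: is_cderive_cst.
rewrite big_cons; have -> : (fun t => \sum_(j <- i :: s | P j) f j t) =
    (fun t => if P i then f i t + \sum_(j <- s | P j) f j t
              else \sum_(j <- s | P j) f j t).
  by apply/funext => t'; rewrite big_cons.
case Pi: (P i) => //.
by apply: is_cderiveD => //; exact: h.
Qed.

Lemma right_continuous_sum (R : realType) (I : Type) (s : seq I) (P : pred I)
    (f : I -> R -> R[i]) (t : R) :
  (forall i, P i -> right_continuous_at (f i) t) ->
  right_continuous_at (fun s' => \sum_(i <- s | P i) f i s') t.
Proof.
move=> h; elim: s => [|i s ih].
  have -> : (fun t => \sum_(i <- [::] | P i) f i t) = fun=> 0.
    by apply/funext => t'; rewrite big_nil.
  exact: right_continuous_cst.
have -> : (fun t => \sum_(j <- i :: s | P j) f j t) =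
    (fun t => if P i then f i t + \sum_(j <- s | P j) f j t
              else \sum_(j <- s | P j) f j t).
  by apply/funext => t'; rewrite big_cons.
case Pi: (P i) => //.
by apply: right_continuousD => //; exact: h.
Qed.

Lemma linear_modeM (R : realType) (c d : R[i]) (f g : R -> R[i]) :
  linear_mode c f -> linear_mode d g ->
  linear_mode (c + d) (fun t => f t * g t).
Proof.
move=> [f0 df] [g0 dg]; split; first exact: right_continuousM.
move=> t t0; have := is_cderiveM (df t t0) (dg t t0).
by congr is_cderive; ring.
Qed.

Lemma linear_mode_conj (R : realType) (c : R[i]) (f : R -> R[i]) :
  linear_mode c f -> linear_mode (conjc c) (fun t => (conjc (f t))).
Proof.
have [Rc Ic] := (@conjc_Re R, @conjc_Im R).
move=> [[r0 j0] df]; split.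
  split; first by under eq_fun do rewrite Rc; rewrite Rc.
  by under eq_fun do rewrite Ic; rewrite Ic; exact: cvgN.
move=> t t0; have [dr dj] := df t t0; split.
  under eq_fun do rewrite Rc; apply: (is_derive_eq dr).
  by rewrite !ReM !Rc !Ic; ring.
under eq_fun do rewrite Ic; apply: (is_derive_eq (is_deriveN dj)).
by rewrite !ImM !Rc !Ic; ring.
Qed.

Definition sqmod (R : realType) (z : R[i]) : R :=
  complex.Re z ^+ 2 + complex.Im z ^+ 2.

Lemma sqmod_ge0 (R : realType) (z : R[i]) : 0 <= sqmod z.
Proof. by rewrite addr_ge0// sqr_ge0. Qed.

Lemma sqmodM (R : realType) (x y : R[i]) : sqmod (x * y) = sqmod x * sqmod y.
Proof. by rewrite /sqmod ReM ImM; ring. Qed.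

Lemma sqmod_normc (R : realType) (z : R[i]) : sqmod z = Normc.normc z ^+ 2.
Proof. by case: z => a b; rewrite /= sqr_sqrtr// addr_ge0// sqr_ge0. Qed.

Lemma sqmod_Re (R : realType) (z : R[i]) : sqmod z = complex.Re (z * (conjc z)).
Proof. by case: z => a b; rewrite /sqmod ReM/=; ring. Qed.

Lemma normc_ge0 (R : realType) (z : R[i]) : 0 <= Normc.normc z.
Proof. by case: z => a b; exact: sqrtr_ge0. Qed.

Lemma Re_le_normc (R : realType) (z : R[i]) : `|complex.Re z| <= Normc.normc z.
Proof.
case: z => a b /=; rewrite -sqrtr_sqr; apply: ler_wsqrtr.
by rewrite lerDl sqr_ge0.
Qed.

Lemma Im_le_normc (R : realType) (z : R[i]) : `|complex.Im z| <= Normc.normc z.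
Proof.
case: z => a b /=; rewrite -sqrtr_sqr; apply: ler_wsqrtr.
by rewrite lerDr sqr_ge0.
Qed.

Lemma regular_sqmod (R : realType) (f : R -> R[i]) :
  right_continuous_at f 0 ->
  (forall t : R, 0 < t -> exists d, is_cderive f t d) ->
  regular (fun t => sqmod (f t)).
Proof.
move=> [r0 j0] df; rewrite /sqmod.
have Rr : regular (fun t => complex.Re (f t)).
  by split=> // t /df[d [[]]].
have Rj : regular (fun t => complex.Im (f t)).
  by split=> // t /df[d [_ []]].
by under eq_fun do rewrite !expr2; apply: regularD; exact: regularM.
Qed.

Lemma linear_mode_sqmod (R : realType) (c : R[i]) (f : R -> R[i]) :
  linear_mode c f ->
  (fun t => sqmod (f t)) s @[s --> 0^'+] --> sqmod (f 0) /\
  forall t : R, 0 < t ->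
    is_derive t 1 (fun s => sqmod (f s)) (2 * complex.Re c * sqmod (f t)).
Proof.
move=> mf; have [[r0 _] d] := linear_modeM mf (linear_mode_conj mf); split.
  by under eq_fun do rewrite sqmod_Re; rewrite sqmod_Re.
move=> t t0; have [dr _] := d t t0.
under eq_fun do rewrite sqmod_Re; apply: (is_derive_eq dr).
rewrite /sqmod; case: c {d mf dr} => a b; case: (f t) => x y.
by rewrite !ReM !ImM/=; ring.
Qed.

Lemma linear_mode_decay (R : realType) (c : R[i]) (f : R -> R[i]) (t : R) :
  linear_mode c f -> complex.Re c <= 0 -> 0 <= t ->
  Normc.normc (f t) <= Normc.normc (f 0).
Proof.
move=> mf c0; rewrite le_eqVlt => /predU1P[<-//|t0].
have [r0 d] := linear_mode_sqmod mf.
have cf : {within `[0, t], continuous (fun s => sqmod (f s))}.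
  by apply: regular_within => //; split=> // s /d[].
have ds (x : R) : x \in `]0, t[ ->
    is_derive x 1 (fun s => sqmod (f s)) (2 * complex.Re c * sqmod (f x)).
  by move=> /[!in_itv]/= /andP[/d].
have [s st e] := MVT t0 ds cf.
rewrite -(@ler_pXn2r _ 2)// ?nnegrE ?normc_ge0// -!sqmod_normc -subr_le0 e.
rewrite mulr_le0_ge0 ?subr0 ?(ltW t0)// mulr_le0_ge0 ?sqmod_ge0//.
by rewrite mulr_ge0_le0.
Qed.

(** An oscillating or decaying mode is its own derivative up to the factor [c],
    so [Re (f / c)] is a primitive of [Re f]; since the modulus decays, the bound
    does not depend on [T] and improves with the size of the rate [c]. *)
Lemma increment_bound_mode (R : realType) (T : R) (c : R[i]) (f : R -> R[i]) :
  linear_mode c f -> complex.Re c <= 0 -> c != 0 -> 0 <= T ->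
  increment_bound T (fun t => complex.Re (f t))
    (2 * (Normc.normc (f 0) / Normc.normc c)).
Proof.
move=> mf c0 cn0 T0; have [fr df] := mf.
have [r0 _] := right_continuousM (right_continuous_cst c^-1 0) fr.
exists (fun t => complex.Re (c^-1 * f t)); split=> //.
  move=> t t0; have [d _] := is_cderiveM (is_cderive_cst c^-1 t) (df t t0).
  exists (complex.Re (f t)) => //; apply: (is_derive_eq d).
  by rewrite mul0r add0r mulKf.
have b (t : R) : 0 <= t ->
    `|complex.Re (c^-1 * f t)| <= Normc.normc (f 0) / Normc.normc c.
  move=> t0; apply: (le_trans (Re_le_normc _)).
  rewrite Normc.normcM Normc.normcV mulrC ler_wpM2r ?invr_ge0 ?normc_ge0//.
  exact: linear_mode_decay mf c0 t0.
have := b T T0; have := b 0 (lexx _); rewrite !ler_norml.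
by move=> /andP[? ?] /andP[? ?]; lra.
Qed.

(** * Trigonometry and the resonance function *)

(** The slope of the cosine is at least [-1]. *)
Lemma one_sub_le_cos (R : realType) (x : R) : 0 <= x -> 1 - x <= cos x.
Proof.
move=> x0; have dc (y : R) : y \in `]0, x[ -> is_derive y 1 cos (- sin y).
  by move=> _; exact: is_derive_cos.
have cc : {within `[0, x], continuous (@cos R)}.
  exact/continuous_subspaceT/continuous_cos.
have [c _] := MVT_segment x0 dc cc.
rewrite cos0 subr0 => e; have := ler_wpM2r x0 (sin_le1 c).
by rewrite mul1r; lra.
Qed.

(** On this interval the slope of the sine is a cosine, which is at least
    [1 / 2] by the previous bound. *)
Lemma half_le_sin (R : realType) (x : R) : 0 <= x <= 1 / 2 -> x / 2 <= sin x.
Proof.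
move=> /andP[x0 x1]; have ds (y : R) : y \in `]0, x[ -> is_derive y 1 sin (cos y).
  by move=> _; exact: is_derive_sin.
have cs : {within `[0, x], continuous (@sin R)}.
  exact/continuous_subspaceT/continuous_sin.
have [c] := MVT_segment x0 ds cs.
rewrite in_itv/= => /andP[c0 cx]; rewrite sin0 !subr0 => ->.
have := one_sub_le_cos c0; rewrite mulrC => h.
by apply: ler_wpM2r => //; lra.
Qed.

Lemma norm_half_le_sin (R : realType) (x : R) :
  `|x| <= 1 / 2 -> `|x| / 2 <= `|sin x|.
Proof.
move=> x1; have [x0|x0] := leP 0 x.
  rewrite ger0_norm// in x1 *; apply: le_trans (ler_norm _).
  by apply: half_le_sin; rewrite x0.
rewrite ltr0_norm// in x1 *; rewrite -normrN -sinN; apply: le_trans (ler_norm _).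
by apply: half_le_sin; rewrite x1 oppr_ge0 ltW.
Qed.

(** With [s] the common sum, [cos x1 + cos x2 = 2 cos (s / 2) cos ((x1 - x2) / 2)]
    and likewise for the [y]s; the difference of the two cosines that remain is
    again a product. *)
Lemma cos_resonance_factor (R : realType) (x1 x2 y1 y2 : R) :
  x1 + x2 = y1 + y2 ->
  cos x1 + cos x2 - cos y1 - cos y2 =
  - 4 * cos ((x1 + x2) / 2) * sin ((x1 - y1) / 2) * sin ((y1 - x2) / 2).
Proof.
move=> e; set p := (x1 + x2) / 2; set q := (x1 - y1) / 2; set r := (y1 - x2) / 2.
have [E1 E2 E3 E4] : [/\ x1 = p + (q + r), x2 = p - (q + r), y1 = p + (r - q)
    & y2 = p - (r - q)] by rewrite /p /q /r; split; lra.
clearbody p q r; rewrite E1 E2 E3 E4.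
by rewrite !(cosB p) !(cosD p) (cosD q) (cosB r); ring.
Qed.

(** The discrete counterpart of
    [l1^2 + l2^2 - k1^2 - k2^2 = 2 (l1 - k1) (l1 - k2)] when
    [k1 + k2 = l1 + l2]. Away from the inflection points of the dispersion
    relation, the factor [cos ((x1 + x2) / 2)] stays away from [0], and the four
    frequencies resonate only in the trivial cases [y1 = x1] and [y1 = x2]. *)
Lemma cos_resonance_gap (R : realType) (x1 x2 y1 y2 : R) :
  0 <= x1 <= 1 / 2 -> 0 <= x2 <= 1 / 2 -> 0 <= y1 <= 1 / 2 ->
  x1 + x2 = y1 + y2 ->
  `|x1 - y1| * `|y1 - x2| / 8 <= `|cos x1 + cos x2 - cos y1 - cos y2|.
Proof.
move=> /andP[x1l x1r] /andP[x2l x2r] /andP[y1l y1r] e.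
rewrite (cos_resonance_factor e) !normrM normrN.
have c2 : 1 / 2 <= `|cos ((x1 + x2) / 2)|.
  apply: le_trans (ler_norm _); apply: le_trans (one_sub_le_cos _); lra.
have half (x : R) : `|x / 2| = `|x| / 2.
  by rewrite normrM (ger0_norm (x := 2^-1))// invr_ge0.
have q2 : `|x1 - y1| / 4 <= `|sin ((x1 - y1) / 2)|.
  have := @norm_half_le_sin _ ((x1 - y1) / 2); rewrite half => h.
  have /h : `|x1 - y1| / 2 <= 1 / 2.
    have : `|x1 - y1| <= 1 by rewrite ler_norml; lra.
    by lra.
  by lra.
have r2 : `|y1 - x2| / 4 <= `|sin ((y1 - x2) / 2)|.
  have := @norm_half_le_sin _ ((y1 - x2) / 2); rewrite half => h.
  have /h : `|y1 - x2| / 2 <= 1 / 2.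
    have : `|y1 - x2| <= 1 by rewrite ler_norml; lra.
    by lra.
  by lra.
rewrite (ger0_norm (x := 4))//.
have -> : `|x1 - y1| * `|y1 - x2| / 8 =
  4 * (1 / 2) * (`|x1 - y1| / 4) * (`|y1 - x2| / 4) by field.
have d4 (x : R) : 0 <= `|x| / 4 by rewrite divr_ge0.
have c1 : 4 * (1 / 2) <= 4 * `|cos ((x1 + x2) / 2)| by lra.
have c0 : 0 <= 4 * (1 / 2) :> R by lra.
exact: ler_pM (mulr_ge0 c0 (d4 _)) (d4 _) (ler_pM c0 (d4 _) c1 q2) r2.
Qed.

Lemma cos_le_away (R : realType) (d x : R) :
  0 <= d <= pi -> d <= x -> x <= 2 * pi - d -> cos x <= cos d.
Proof.
move=> /andP[d0 dpi] dx xd.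
have half_period (y : R) : d <= y <= pi -> cos y <= cos d.
  move=> /andP[dy ypi]; rewrite leNgt ltr_cos ?in_itv/= ?d0 ?dpi ?ypi ?(le_trans d0)//.
  by rewrite -leNgt.
have [xpi|pix] := leP x pi; first by apply: half_period; rewrite dx.
have -> : cos x = cos (pi *+ 2 - x) by rewrite cosB cos2pi sin2pi; ring.
by apply: half_period; rewrite mulr2n; lra.
Qed.

Definition unit_angle (R : realType) (N : nat) : R := 2 * pi / N.+1%:R.

Definition expi (R : realType) (x : R) : R[i] := cos x +i* sin x.

Lemma expiX (R : realType) (x : R) (n : nat) : expi x ^+ n = expi (n%:R * x).
Proof.
elim: n => [|n ih].
  by rewrite expr0 mul0r /expi cos0 sin0.
rewrite exprS ih -nat1r mulrDl mul1r /expi cosD sinD.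
by apply: complexP; rewrite ?ReM ?ImM/=; ring.
Qed.

Lemma expi_conj (R : realType) (x : R) : (conjc (expi x)) = expi (- x).
Proof. by rewrite /expi cosN sinN. Qed.

Lemma expi_mul_conj (R : realType) (x : R) : expi x * (conjc (expi x)) = 1.
Proof.
apply: complexP; rewrite ?ReM ?ImM/=; last by ring.
by rewrite mulrN opprK -!expr2 cos2Dsin2.
Qed.

Lemma cos_lt1 (R : realType) (x : R) : 0 < x < 2 * pi -> cos x < 1.
Proof.
move=> x2pi; have -> : x = (x / 2) *+ 2 by rewrite mulr2n; lra.
have /exprn_gt0 -/(_ 2%N) : 0 < sin (x / 2) by apply: sin_gt0_pi; lra.
by rewrite cos_mulr2n cos2sin2 mulr2n => s; lra.
Qed.

Lemma expi_prim (R : realType) (N : nat) :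
  N.+1.-primitive_root (expi (unit_angle R N)).
Proof.
have N0 : 0 < N.+1%:R :> R by [].
apply/andP; split=> //; apply/forallP => -[i iN].
rewrite unity_rootE expiX /=; have [->|iN'] := eqVneq i.+1 N.+1.
  rewrite (_ : _ * _ = pi *+ 2); last by rewrite /unit_angle mulr2n; field.
  by rewrite /expi cos2pi sin2pi eqxx.
rewrite eqbF_neg; apply/eqP => /(congr1 (@complex.Re R))/=.
have /cos_lt1 : 0 < i.+1%:R * unit_angle R N < 2 * pi.
  rewrite /unit_angle mulrCA; have p0 := @pi_gt0 R.
  rewrite !mulr_gt0// ?invr_gt0//=.
  rewrite gtr_pMr ?mulr_gt0//.
  rewrite ltr_pdivrMr// mul1r ltr_nat.
  by rewrite ltn_neqAle iN' iN.
by move=> /lt_eqF/eqP.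
Qed.

(** * Fourier analysis of the scheme *)

(** The two roots of unity [exp (i theta)] and [exp (- i theta)], with
    [theta = 2 pi / (N + 1)], are treated alike: both generate the characters and
    both diagonalize the discrete Laplacian with the same eigenvalues. *)
Definition fourier_root (R : realType) (N : nat) (chi : R[i]) : Prop :=
  [/\ N.+1.-primitive_root chi, chi * conjc chi = 1 &
      forall k, chi ^+ k + conjc chi ^+ k = (2 * cos (k%:R * unit_angle R N))%:C].

Lemma fourier_root_expi (R : realType) (N : nat) :
  fourier_root N (expi (unit_angle R N)).
Proof.
split; [exact: expi_prim|exact: expi_mul_conj|move=> k].
rewrite expi_conj !expiX mulrN /expi cosN sinN.
by apply: complexP => /=; rewrite ?subrr//; ring.
Qed.

Lemma fourier_root_conj (R : realType) (N : nat) (chi : R[i]) :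
  fourier_root N chi -> fourier_root N (conjc chi).
Proof.
move=> [pr ch e]; split; last move=> k; rewrite ?conjcK.
- by rewrite fmorph_primitive_root.
- by rewrite mulrC.
- by rewrite addrC.
Qed.

Lemma mesh_gt0 (R : realType) (N : nat) : 0 < mesh R N.
Proof. by rewrite invr_gt0. Qed.

Lemma meshM (R : realType) (N : nat) : mesh R N * N.+1%:R = 1.
Proof. by rewrite mulVf. Qed.

Lemma mesh_angle (R : realType) (N : nat) : unit_angle R N = 2 * pi * mesh R N.
Proof. by []. Qed.

Lemma fourier_orthogonality (R : realType) (N : nat) (chi : R[i]) (n m : nat) :
  fourier_root N chi -> (n < N.+1)%N -> (m < N.+1)%N ->
  (mesh R N)%:C * \sum_(j < N.+1) chi ^+ (n * j) * conjc chi ^+ (m * j) =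
  (n == m)%:R.
Proof.
move=> [pr ch _] nN mN; pose z := chi ^+ n * conjc chi ^+ m.
have -> : \sum_(j < N.+1) chi ^+ (n * j) * conjc chi ^+ (m * j) =
    \sum_(j < N.+1) z ^+ j.
  by apply: eq_bigr => j _; rewrite /z exprMn -!exprM.
have [enm|nm] := eqVneq n m.
  have -> : z = 1 by rewrite /z enm -exprMn ch expr1n.
  under eq_bigr do rewrite expr1n.
  by rewrite sumr_const card_ord -(rmorph_nat (real_complex R)) -rmorphM/= meshM.
have z1 : z - 1 != 0.
  rewrite subr_eq0; apply: contra nm => /eqP zE.
  have : chi ^+ n == chi ^+ m.
    have <- : z * chi ^+ m = chi ^+ n.
      by rewrite /z -mulrA -exprMn (mulrC (conjc chi)) ch expr1n mulr1.
    by rewrite zE mul1r.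
  by rewrite (eq_prim_root_expr pr) !modn_small.
have zN : z ^+ N.+1 = 1.
  rewrite /z exprMn -!exprM !(mulnC _ N.+1) !exprM -rmorphXn/=.
  by rewrite (prim_expr_order pr) rmorph1 !expr1n mulr1.
have /eqP := subrX1 z N.+1.
by rewrite zN subrr eq_sym mulf_eq0 (negbTE z1)/= => /eqP ->; rewrite mulr0.
Qed.

(** Parseval's identity for sums whose frequencies [n i] may coincide: only the
    pairs with the same frequency survive the mean over the grid. It is used with
    pairs of frequencies for the square of a band-limited vector, and with
    single frequencies for the vector itself. *)
Lemma mean_sqmod_char_sum (R : realType) (N : nat) (chi : R[i]) (J : finType)
    (P : pred J) (n : J -> nat) (c : J -> R[i]) :
  fourier_root N chi -> (forall i, P i -> (n i < N.+1)%N) ->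
  mesh R N * \sum_(j < N.+1) sqmod (\sum_(i | P i) c i * chi ^+ (n i * j)) =
  \sum_(i | P i) \sum_(i' | P i' && (n i == n i'))
    complex.Re (c i * conjc (c i')).
Proof.
move=> chiP nN.
have e : (mesh R N)%:C * \sum_(j < N.+1)
    (\sum_(i | P i) c i * chi ^+ (n i * j)) *
    (conjc (\sum_(i | P i) c i * chi ^+ (n i * j))) =
    \sum_(i | P i) \sum_(i' | P i' && (n i == n i')) c i * (conjc (c i')).
  have -> : \sum_(j < N.+1)
      (\sum_(i | P i) c i * chi ^+ (n i * j)) *
      (conjc (\sum_(i | P i) c i * chi ^+ (n i * j))) =
    \sum_(j < N.+1) \sum_(i | P i) \sum_(i' | P i')
      c i * (conjc (c i')) * (chi ^+ (n i * j) * conjc chi ^+ (n i' * j)).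
    apply: eq_bigr => j _; rewrite rmorph_sum/= mulr_suml; apply: eq_bigr => i _.
    rewrite mulr_sumr; apply: eq_bigr => i' _; rewrite rmorphM rmorphXn/=.
    by ring.
  rewrite exchange_big mulr_sumr; apply: eq_bigr => i Pi.
  rewrite exchange_big mulr_sumr big_mkcondr; apply: eq_bigr => i' Pi'.
  rewrite -mulr_sumr mulrCA fourier_orthogonality ?nN//.
  by case: eqP; rewrite ?mulr1 ?mulr0.
rewrite (eq_bigr _ (fun (j : 'I_N.+1) _ => sqmod_Re _)) -Re_sum.
have := congr1 (@complex.Re R) e; rewrite ReM /= mul0r subr0 => ->.
by rewrite Re_sum; apply: eq_bigr => i _; rewrite Re_sum.
Qed.

Definition dft (R : realType) (N : nat) (chi : R[i]) (v : 'rV[R[i]]_N.+1)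
    (k : nat) : R[i] :=
  (mesh R N)%:C * \sum_(j < N.+1) v 0 j * conjc chi ^+ (k * j).

Lemma dft_inversion (R : realType) (N : nat) (chi : R[i])
    (v : 'rV[R[i]]_N.+1) (j : 'I_N.+1) :
  fourier_root N chi -> v 0 j = \sum_(k < N.+1) dft chi v k * chi ^+ (k * j).
Proof.
move=> chiP; rewrite /dft.
under eq_bigr do rewrite -mulrA mulr_suml.
have term (i : 'I_N.+1) : (mesh R N)%:C *
    (\sum_(k < N.+1) v 0 i * conjc chi ^+ (k * i) * chi ^+ (k * j)) =
    v 0 i * (j == i)%:R.
  rewrite -(fourier_orthogonality chiP (ltn_ord j) (ltn_ord i)) mulrCA.
  rewrite [in RHS]mulr_sumr; congr (_ * _); apply: eq_bigr => k _.
  by rewrite (mulnC j) (mulnC i); ring.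
rewrite -mulr_sumr exchange_big mulr_sumr (eq_bigr _ (fun i _ => term i)).
rewrite (bigD1 j)//= eqxx mulr1 big1 ?addr0// => i ij.
by rewrite eq_sym (negbTE ij) mulr0.
Qed.

Lemma parseval (R : realType) (N : nat) (chi : R[i]) (P : pred 'I_N.+1)
    (c : 'I_N.+1 -> R[i]) :
  fourier_root N chi ->
  mesh R N * \sum_(j < N.+1) sqmod (\sum_(k | P k) c k * chi ^+ (k * j)) =
  \sum_(k | P k) sqmod (c k).
Proof.
move=> chiP; rewrite mean_sqmod_char_sum//; apply: eq_bigr => k Pk.
rewrite (bigD1 k)/=; last by rewrite Pk eqxx.
rewrite big1 ?addr0 -?sqmod_Re// => i /andP[/andP[_ /eqP /val_inj ->]].
by rewrite eqxx.
Qed.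

Lemma dft_isometry (R : realType) (N : nat) (chi : R[i]) (v : 'rV[R[i]]_N.+1) :
  fourier_root N chi ->
  \sum_(k < N.+1) sqmod (dft chi v k) = mesh R N * \sum_(j < N.+1) sqmod (v 0 j).
Proof.
move=> chiP; rewrite -(parseval predT _ chiP); congr (_ * _).
by apply: eq_bigr => j _; rewrite -dft_inversion.
Qed.

Definition dispersion (R : realType) (N k : nat) : R :=
  (2 - 2 * cos (k%:R * unit_angle R N)) / mesh R N ^+ 2.

(** The characters are eigenvectors because summation over the cyclic grid is
    invariant under the shifts. *)
Lemma dft_discrete_laplacian (R : realType) (N : nat) (chi : R[i])
    (v : 'rV[R[i]]_N.+1) (k : nat) :
  fourier_root N chi ->
  dft chi (\row_j discrete_laplacian v j) k =
  - (dispersion R N k)%:C * dft chi v k.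
Proof.
move=> [pr ch ck]; rewrite /dft mulrCA; congr (_ * _).
have chi_mod (n : nat) : conjc chi ^+ (k * (n %% N.+1)) = conjc chi ^+ (k * n).
  have e : conjc chi ^+ N.+1 = 1 by rewrite -rmorphXn/= (prim_expr_order pr) rmorph1.
  by rewrite !(mulnC k) !exprM expr_mod.
have succ : \sum_(j < N.+1) v 0 (ordS j) * conjc chi ^+ (k * j) =
    chi ^+ k * \sum_(j < N.+1) v 0 j * conjc chi ^+ (k * j).
  rewrite [in RHS](reindex_inj (@ordS_inj N.+1)) mulr_sumr; apply: eq_bigr => j _ /=.
  rewrite chi_mod mulnS exprD mulrCA (mulrA (chi ^+ k)) -exprMn ch expr1n.
  by rewrite mul1r.
have pred : \sum_(j < N.+1) v 0 (ord_pred j) * conjc chi ^+ (k * j) =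
    conjc chi ^+ k * \sum_(j < N.+1) v 0 j * conjc chi ^+ (k * j).
  rewrite [in LHS](reindex_inj (@ordS_inj N.+1)) mulr_sumr; apply: eq_bigr => j _.
  by rewrite ordSK /= chi_mod mulnS exprD; ring.
rewrite /discrete_laplacian.
transitivity (((mesh R N)%:C ^+ 2)^-1 *
   ((\sum_(j < N.+1) v 0 (ordS j) * conjc chi ^+ (k * j)) -
    2 * (\sum_(j < N.+1) v 0 j * conjc chi ^+ (k * j)) +
    \sum_(j < N.+1) v 0 (ord_pred j) * conjc chi ^+ (k * j))).
  rewrite [in RHS]mulr_sumr -sumrB -big_split/= mulr_sumr; apply: eq_bigr => j _.
  by rewrite mxE; ring.
rewrite succ pred -mulrBl -mulrDl mulrA; congr (_ * _).
have -> : (dispersion R N k)%:C =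
    (2 - (2 * cos (k%:R * unit_angle R N))%:C) / (mesh R N)%:C ^+ 2 :> R[i].
  rewrite -rmorphXn -(rmorph_nat (real_complex R)) -rmorphB -fmorphV -rmorphM.
  by [].
rewrite -ck; ring.
Qed.

(** The symbol [- (a + i) lambda_k] of the operator [(a + i) Delta_h], which is
    the right-hand side of the scheme once solved for the time derivative. *)
Definition wave_rate (R : realType) (a : R) (N k : nat) : R[i] :=
  - (a +i* 1) * (dispersion R N k)%:C.

Lemma Re_wave_rate (R : realType) (a : R) (N k : nat) :
  complex.Re (wave_rate a N k) = - a * dispersion R N k.
Proof. by rewrite /wave_rate ReM/=; ring. Qed.

Lemma Im_wave_rate (R : realType) (a : R) (N k : nat) :
  complex.Im (wave_rate a N k) = - dispersion R N k.
Proof. by rewrite /wave_rate ImM/=; ring. Qed.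

Lemma dispersion_ge0 (R : realType) (N k : nat) : 0 <= dispersion R N k.
Proof.
rewrite divr_ge0 ?sqr_ge0//; have := cos_le1 (k%:R * unit_angle R N); lra.
Qed.

Lemma is_cderive_dft (R : realType) (N : nat) (chi : R[i])
    (u : R -> 'rV[R[i]]_N.+1) (du : 'rV[R[i]]_N.+1) (t : R) (k : nat) :
  (forall j, is_cderive (fun s => u s 0 j) t (du 0 j)) ->
  is_cderive (fun s => dft chi (u s) k) t (dft chi du k).
Proof.
move=> d.
have dS : is_cderive (fun s => \sum_(j < N.+1) u s 0 j * conjc chi ^+ (k * j)) t
    (\sum_(j < N.+1) du 0 j * conjc chi ^+ (k * j)).
  apply: is_cderive_sum => j _.
  have := is_cderiveM (d j) (is_cderive_cst (conjc chi ^+ (k * j)) t).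
  by rewrite mulr0 addr0.
by have := is_cderiveM (is_cderive_cst (mesh R N)%:C t) dS; rewrite mul0r add0r.
Qed.

Lemma right_continuous_dft (R : realType) (N : nat) (chi : R[i])
    (u : R -> 'rV[R[i]]_N.+1) (t : R) (k : nat) :
  (forall j, right_continuous_at (fun s => u s 0 j) t) ->
  right_continuous_at (fun s => dft chi (u s) k) t.
Proof.
move=> d; apply: right_continuousM; first exact: right_continuous_cst.
apply: right_continuous_sum => j _; apply: right_continuousM => //.
exact: right_continuous_cst.
Qed.

Lemma dft_linear_mode (R : realType) (a : R -> R) (N : nat) (chi : R[i])
    (phi : 'rV[R[i]]_N.+1) (u : R -> 'rV[R[i]]_N.+1) (k : nat) :
  fourier_root N chi -> viscous_solution a phi u ->
  linear_mode (wave_rate (a (mesh R N)) N k)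
    (fun t => dft chi (u t) k).
Proof.
move=> chiP [_ u0 du]; split; first exact: right_continuous_dft.
move=> t t0; rewrite /wave_rate.
have -> : - (a (mesh R N) +i* 1) * (dispersion R N k)%:C * dft chi (u t) k =
    dft chi (\row_j ((a (mesh R N) +i* 1) * discrete_laplacian (u t) j)) k.
  rewrite mulNr -mulrN -mulrA -dft_discrete_laplacian// /dft mulrCA.
  congr (_ * _); rewrite mulr_sumr; apply: eq_bigr => j _.
  by rewrite !mxE mulrA.
apply: is_cderive_dft => j; have [d dP e] := du t j t0.
rewrite mxE; suff <- : d = (a (mesh R N) +i* 1) * discrete_laplacian (u t) j by [].
have i2 : 'i%C * 'i%C = -1 :> R[i] by rewrite -expr2 sqr_i.
have -> : a (mesh R N) +i* 1 = (a (mesh R N))%:C + 'i%C.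
  by apply: complexP; rewrite ?ReD ?ImD /= ?addr0 ?add0r.
have -> : d = - ('i%C * ('i%C * d)) by rewrite mulrA i2 mulN1r opprK.
have -> : 'i%C * d = 'i%C * (a (mesh R N))%:C * discrete_laplacian (u t) j
   - discrete_laplacian (u t) j by rewrite -e; ring.
by rewrite mulrBr !mulrA i2; ring.
Qed.

(** * Low frequencies: dispersion *)

Lemma inv_sqr_telescope (R : realType) (x : R) :
  1 <= x -> (x ^+ 2)^-1 <= 2 / x - 2 / (x + 1).
Proof.
move=> x1; have x0 : 0 < x by lra.
have -> : 2 / x - 2 / (x + 1) = (x ^+ 2)^-1 * (2 * x / (x + 1)).
  by field; rewrite !gt_eqF//; lra.
by rewrite ler_peMr ?invr_ge0 ?sqr_ge0// ler_pdivlMr; lra.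
Qed.

Lemma sum_inv_sqr_below (R : realType) (k M : nat) : (M <= k)%N ->
  \sum_(l < M) ((k%:R - l%:R) ^+ 2)^-1 <= 2 / (k%:R - M%:R + 1) :> R.
Proof.
elim: M => [|M ih] Mk.
  by rewrite big_ord0 subr0 divr_ge0// addr_ge0.
rewrite big_ord_recr/=; have := ih (ltnW Mk).
set x : R := k%:R - M%:R => h.
have x1 : 1 <= x by rewrite /x lerBrDr nat1r ler_nat.
have -> : k%:R - M.+1%:R + 1 = x by rewrite /x -natr1; ring.
by have := inv_sqr_telescope x1; lra.
Qed.

Lemma sum_inv_sqr_above (R : realType) (k d : nat) :
  \sum_(l < k.+1 + d) ((k%:R - l%:R) ^+ 2)^-1 <= 4 - 2 / (d%:R + 1) :> R.
Proof.
elim: d => [|d ih].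
  rewrite addn0 big_ord_recr/= subrr expr0n invr0.
  by have := @sum_inv_sqr_below R k k (leqnn k); rewrite subrr !add0r divr1; lra.
rewrite addnS big_ord_recr/=.
have -> : k%:R - (k + d).+1%:R = - (d%:R + 1) :> R by rewrite -natr1 natrD; ring.
move: ih; rewrite -(natr1 d) sqrrN; set x : R := d%:R + 1 => h.
have x1 : 1 <= x by rewrite /x lerDr.
by have := inv_sqr_telescope x1; lra.
Qed.

(** The term [l = k] contributes [0], as [0^-1 = 0]. *)
Lemma sum_inv_sqr_dist (R : realType) (N : nat) (k : 'I_N) :
  \sum_(l < N) ((k%:R - l%:R) ^+ 2)^-1 <= 4 :> R.
Proof.
have := @sum_inv_sqr_above R k (N - k.+1); rewrite subnKC//.
by move=> /le_trans; apply; rewrite gerBl divr_ge0// addr_ge0.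
Qed.

(** By [p i * p j <= (p i ^ 2 + p j ^ 2) / 2], symmetry makes the two resulting
    sums equal. *)
Lemma schur_test (R : realType) (J : finType) (P : pred J) (r : rel J)
    (K : J -> J -> R) (p : J -> R) (C : R) :
  symmetric r -> (forall i j, 0 <= K i j) ->
  (forall i j, r i j -> K i j = K j i) ->
  (forall i, P i -> \sum_(j | P j && r i j) K i j <= C) ->
  \sum_(i | P i) \sum_(j | P j && r i j) K i j * (p i * p j) <=
  C * \sum_(i | P i) p i ^+ 2.
Proof.
move=> rC K0 KC KC'.
have row : \sum_(i | P i) \sum_(j | P j && r i j) K i j * p i ^+ 2 <=
    C * \sum_(i | P i) p i ^+ 2.
  rewrite mulr_sumr; apply: ler_sum => i Pi.
  by rewrite -mulr_suml; apply: ler_wpM2r; [exact: sqr_ge0|exact: KC'].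
have col : \sum_(i | P i) \sum_(j | P j && r i j) K i j * p j ^+ 2 =
    \sum_(i | P i) \sum_(j | P j && r i j) K i j * p i ^+ 2.
  rewrite (exchange_big_dep P)/=; last by move=> i j _ /andP[].
  apply: eq_bigr => i Pi; apply: eq_big => [j|j /andP[_ /andP[_ rij]]].
    by rewrite Pi/= rC.
  by rewrite KC.
suff : \sum_(i | P i) \sum_(j | P j && r i j) K i j * (p i * p j) <=
    \sum_(i | P i) \sum_(j | P j && r i j) (K i j * p i ^+ 2) / 2 +
    \sum_(i | P i) \sum_(j | P j && r i j) (K i j * p j ^+ 2) / 2.
  have halves (f : J -> J -> R) :
      \sum_(i | P i) \sum_(j | P j && r i j) f i j / 2 =
      (\sum_(i | P i) \sum_(j | P j && r i j) f i j) / 2.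
    by rewrite mulr_suml; apply: eq_bigr => i _; rewrite mulr_suml.
  rewrite (halves (fun i j => K i j * p i ^+ 2)).
  by rewrite (halves (fun i j => K i j * p j ^+ 2)) col; lra.
rewrite -big_split/=; apply: ler_sum => i Pi.
rewrite -big_split/=; apply: ler_sum => j _.
have : 0 <= K i j * (p i - p j) ^+ 2 by rewrite mulr_ge0// sqr_ge0.
have -> : K i j * (p i - p j) ^+ 2 =
  K i j * p i ^+ 2 + K i j * p j ^+ 2 - 2 * (K i j * (p i * p j)) by ring.
by lra.
Qed.

(** On an antidiagonal the first component determines the second. *)
Lemma sum_antidiagonal_le (R : realType) (N s : nat) (P : pred ('I_N * 'I_N))
    (g : 'I_N -> R) :
  (forall l, 0 <= g l) ->
  \sum_(i | P i && (s == i.1 + i.2)%N) g i.1 <= \sum_l g l.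
Proof.
move=> g0; have -> : \sum_(i | P i && (s == i.1 + i.2)%N) g i.1 =
    \sum_(l < N) \sum_(m < N | P (l, m) && (s == l + m)%N) g l.
  by rewrite pair_big_dep/=; apply: eq_bigl => -[l m].
apply: ler_sum => l _.
have [/existsP[m Qm]|/existsPn Q0] :=
    boolP [exists m : 'I_N, P (l, m) && (s == l + m)%N].
  rewrite (bigD1 m)//= big1 ?addr0// => m' /andP[/andP[_ /eqP e] /eqP m'm].
  case: m'm; apply: val_inj; apply/eqP.
  by move/andP: Qm => [_]; rewrite e eqn_add2l.
by rewrite big1// => m Qm; case/negP: (Q0 m).
Qed.

(** The factor [theta^2 / (4 h^2) = pi^2] left by [cos_resonance_gap] cancels the
    mesh size: in these units the gap is the one of the continuous Schroedinger
    equation, uniformly in [N]. *)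
Lemma dispersion_gap (R : realType) (N k1 k2 l1 l2 : nat) :
  k1%:R * unit_angle R N <= 1 / 2 -> k2%:R * unit_angle R N <= 1 / 2 ->
  l1%:R * unit_angle R N <= 1 / 2 -> (k1 + k2 = l1 + l2)%N ->
  `|k1%:R - l1%:R| * `|k2%:R - l1%:R| <=
  `|dispersion R N k1 + dispersion R N k2 - dispersion R N l1
    - dispersion R N l2|.
Proof.
set th := unit_angle R N => K1 K2 L1 e.
have h0 := mesh_gt0 R N; have p0 := @pi_gt0 R; have p2 := @pi_ge2 R.
have th0 : 0 < th by rewrite /th mesh_angle !mulr_gt0.
have n0 (n : nat) : 0 <= n%:R * th by rewrite mulr_ge0// ltW.
have eR : k1%:R * th + k2%:R * th = l1%:R * th + l2%:R * th.
  by rewrite -!mulrDl -!natrD e.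
have -> : dispersion R N k1 + dispersion R N k2 - dispersion R N l1
    - dispersion R N l2 = - (2 / mesh R N ^+ 2) *
   (cos (k1%:R * th) + cos (k2%:R * th) - cos (l1%:R * th) - cos (l2%:R * th)).
  by rewrite /dispersion -/th; field; rewrite gt_eqF.
have c0 : 0 < 2 / mesh R N ^+ 2 by rewrite divr_gt0// exprn_gt0.
rewrite normrM normrN (gtr0_norm c0).
have := cos_resonance_gap (x1 := k1%:R * th) (x2 := k2%:R * th)
  (y1 := l1%:R * th) (y2 := l2%:R * th).
rewrite !n0 K1 K2 L1 => /(_ isT isT isT eR).
rewrite -!mulrBl !(normrM _ th) (gtr0_norm th0) (distrC l1%:R) => gap.
apply: le_trans (ler_wpM2l (ltW c0) gap).
set A : R := `|_|; set B : R := `|_|.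
have A0 : 0 <= A := normr_ge0 _; have B0 : 0 <= B := normr_ge0 _.
have -> : 2 / mesh R N ^+ 2 * (A * th * (B * th) / 8) = pi ^+ 2 * (A * B).
  by rewrite /th mesh_angle; field; rewrite gt_eqF.
by rewrite ler_peMl ?mulr_ge0 ?exprn_ege1 ?(le_trans _ p2) ?ler1n.
Qed.

(** [interaction T k1 l1 + interaction T k2 l1] bounds the time integral of the
    interaction of the pairs [(k1, k2)] and [(l1, l2)] with equal sums: the first
    summand pays [T] for the resonances [l1 = k1] and [l1 = k2]; the second one
    pays for the gap [|k1 - l1| |k2 - l1|], split into two inverse squares by the
    arithmetic-geometric inequality. *)
Definition interaction (R : realType) (T : R) (k l : nat) : R :=
  T * (k == l)%:R + ((k%:R - l%:R) ^+ 2)^-1.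

Lemma interaction_ge0 (R : realType) (T : R) (k l : nat) :
  0 <= T -> 0 <= interaction T k l.
Proof. by move=> T0; rewrite addr_ge0 ?mulr_ge0// invr_ge0 sqr_ge0. Qed.

Lemma quadruple_bound (R : realType) (a T : R) (N : nat) (k1 k2 l1 l2 : nat)
    (f1 f2 g1 g2 : R -> R[i]) :
  0 <= a -> 0 <= T ->
  linear_mode (wave_rate a N k1) f1 -> linear_mode (wave_rate a N k2) f2 ->
  linear_mode (wave_rate a N l1) g1 -> linear_mode (wave_rate a N l2) g2 ->
  k1%:R * unit_angle R N <= 1 / 2 -> k2%:R * unit_angle R N <= 1 / 2 ->
  l1%:R * unit_angle R N <= 1 / 2 -> (k1 + k2 = l1 + l2)%N ->
  increment_bound T (fun t => complex.Re (f1 t * f2 t * conjc (g1 t * g2 t)))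
    ((interaction T k1 l1 + interaction T k2 l1) *
     (Normc.normc (f1 0 * f2 0) * Normc.normc (g1 0 * g2 0))).
Proof.
move=> a0 T0 mf1 mf2 mg1 mg2 K1 K2 L1 e.
have mw := linear_modeM (linear_modeM mf1 mf2)
  (linear_mode_conj (linear_modeM mg1 mg2)).
set c := (X in linear_mode X _) in mw; set w := (fun t => _) in mw *.
have cRe : complex.Re c <= 0.
  rewrite /c !ReD conjc_Re !ReD !Re_wave_rate.
  have d k := mulr_ge0 a0 (@dispersion_ge0 R N k).
  by have := d k1; have := d k2; have := d l1; have := d l2; lra.
have -> : Normc.normc (f1 0 * f2 0) * Normc.normc (g1 0 * g2 0) =
    Normc.normc (w 0) by rewrite /w [RHS]Normc.normcM normc_conj.
have i0 := interaction_ge0 _ _ T0.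
have [|] := boolP ((k1 == l1) || (k2 == l1)) => [res|].
  (* no oscillation is left, so only the decay of the modulus is used *)
  apply: increment_bound_le (increment_bound_cst T (Normc.normc (w 0))).
    move=> t t0; apply: le_trans (linear_mode_decay mw cRe (ltW t0)).
    exact: le_trans (ler_norm _) (Re_le_normc _).
  apply: ler_wpM2r; first exact: normc_ge0.
  case/orP: res => /eqP ->.
    apply: le_trans (_ : interaction T l1 l1 <= _); last by rewrite lerDl.
    by rewrite /interaction eqxx mulr1 lerDl invr_ge0 sqr_ge0.
  apply: le_trans (_ : interaction T l1 l1 <= _); last by rewrite lerDr.
  by rewrite /interaction eqxx mulr1 lerDl invr_ge0 sqr_ge0.
rewrite negb_or => /andP[k1l1 k2l1].
set x : R := `|k1%:R - l1%:R|; set y : R := `|k2%:R - l1%:R|.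
have dist_gt0 (k : nat) : k != l1 -> 0 < `|k%:R - l1%:R : R|.
  by move=> kl; rewrite normr_gt0 subr_eq0 eqr_nat.
have x0 : 0 < x := dist_gt0 _ k1l1; have y0 : 0 < y := dist_gt0 _ k2l1.
have cxy : x * y <= Normc.normc c.
  apply: le_trans (Im_le_normc c).
  rewrite /c !ImD conjc_Im !ImD !Im_wave_rate -normrN.
  apply: le_trans (dispersion_gap K1 K2 L1 e) _.
  by rewrite le_eqVlt; apply/orP; left; apply/eqP; congr `|_|; ring.
have cn0 : 0 < Normc.normc c by apply: lt_le_trans cxy; exact: mulr_gt0.
have c0 : c != 0 by apply: contraTneq cn0 => ->; rewrite Normc.normc0 ltxx.
apply: increment_bound_le (increment_bound_mode mw cRe c0 T0) => //.
rewrite mulrA mulrAC -/(w 0); apply: ler_wpM2r; first exact: normc_ge0.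
rewrite /interaction (negbTE k1l1) (negbTE k2l1) mulr0 !add0r.
apply: le_trans (_ : 2 / (x * y) <= _).
  by rewrite ler_pM2l// lef_pV2// posrE// mulr_gt0.
have -> : (k1%:R - l1%:R) ^+ 2 = x ^+ 2 by rewrite /x real_normK ?num_real.
have -> : (k2%:R - l1%:R) ^+ 2 = y ^+ 2 by rewrite /y real_normK ?num_real.
have : 0 <= (x^-1 - y^-1) ^+ 2 by exact: sqr_ge0.
rewrite sqrrB -!exprVn invfM -mulr_natl => s.
by lra.
Qed.

(** Zygmund's argument. The square of the band-limited vector has the pairs of
    frequencies as its index set, and Parseval's identity leaves the pairs of
    pairs with equal sums. The interactions of such pairs form a kernel whose
    rows are summable, because the sum of the inverse squares converges, so the
    Schur test applies; the mass of the pairs is the square of the mass of the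
    band. *)
Lemma low_band_bound (R : realType) (a T : R) (N : nat) (chi : R[i])
    (P : pred 'I_N.+1) (v : 'I_N.+1 -> R -> R[i]) :
  0 <= a -> 0 <= T -> fourier_root N chi ->
  (forall k, P k -> k%:R * unit_angle R N <= 1 / 2) ->
  (forall k, P k -> linear_mode (wave_rate a N k) (v k)) ->
  increment_bound T
    (fun t => mesh R N *
       \sum_(j < N.+1) sqmod (\sum_(k | P k) v k t * chi ^+ (k * j)) ^+ 2)
    (2 * (T + 4) * (\sum_(k | P k) sqmod (v k 0)) ^+ 2).
Proof.
move=> a0 T0 chiP low mv.
pose P2 (i : 'I_N.+1 * 'I_N.+1) := P i.1 && P i.2.
pose n (i : 'I_N.+1 * 'I_N.+1) := (i.1 + i.2)%N.
pose q (i : 'I_N.+1 * 'I_N.+1) t := v i.1 t * v i.2 t.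
have n_small i : P2 i -> (n i < N.+1)%N.
  move=> /andP[/low l1 /low l2]; rewrite ltnNge; apply/negP => Nn.
  have : N.+1%:R * unit_angle R N <= (n i)%:R * unit_angle R N.
    by rewrite ler_wpM2r ?ler_nat// mesh_angle !mulr_ge0 ?pi_ge0// ltW// mesh_gt0.
  have -> : N.+1%:R * unit_angle R N = 2 * pi by rewrite /unit_angle mulrC divfK.
  rewrite natrD mulrDl.
  by have := @pi_ge2 R; lra.
have key t : mesh R N *
    \sum_(j < N.+1) sqmod (\sum_(k | P k) v k t * chi ^+ (k * j)) ^+ 2 =
    \sum_(i | P2 i) \sum_(i' | P2 i' && (n i == n i'))
      complex.Re (q i t * conjc (q i' t)).
  rewrite -(mean_sqmod_char_sum _ chiP n_small); congr (_ * _).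
  apply: eq_bigr => j _; rewrite expr2 -sqmodM; congr sqmod.
  (* the square of the sum is a sum over the pairs of frequencies *)
  rewrite mulr_suml; under eq_bigr do rewrite mulr_sumr.
  rewrite pair_big/=; apply: eq_bigr => i _.
  by rewrite /q /n mulnDl exprD; ring.
pose W (i i' : 'I_N.+1 * 'I_N.+1) : R :=
  interaction T i.1 i'.1 + interaction T i.2 i'.1.
pose p i := Normc.normc (q i 0).
apply: (@increment_bound_le _ _ _ (fun t => \sum_(i | P2 i)
   \sum_(i' | P2 i' && (n i == n i')) complex.Re (q i t * conjc (q i' t)))
   (\sum_(i | P2 i) \sum_(i' | P2 i' && (n i == n i')) W i i' * (p i * p i'))).
- by move=> t _; rewrite key.
- have -> : (\sum_(k | P k) sqmod (v k 0)) ^+ 2 = \sum_(i | P2 i) p i ^+ 2.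
    rewrite expr2 mulr_suml; under eq_bigr do rewrite mulr_sumr.
    by rewrite pair_big; apply: eq_bigr => i _; rewrite -sqmod_normc sqmodM.
  apply: schur_test.
  + by move=> i i'; rewrite eq_sym.
  + by move=> i i'; rewrite addr_ge0// interaction_ge0.
  + move=> [k1 k2] [l1 l2] /eqP; rewrite /n /W /interaction/= => e.
    have eR : k1%:R - l1%:R = l2%:R - k2%:R :> R.
      by have := congr1 (fun m => m%:R : R) e; rewrite !natrD; lra.
    have eR' : k2%:R - l1%:R = l2%:R - k1%:R :> R by lra.
    have -> : (k2 == l1 :> nat) = (l2 == k1 :> nat) by lia.
    by rewrite eR' (eq_sym (k1 : nat)) -(sqrrN (l1%:R - k1%:R)) opprB.
  + move=> i Pi; rewrite /W.
    have g0 (l : 'I_N.+1) : 0 <= interaction T i.1 l + interaction T i.2 l.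
      by rewrite addr_ge0// interaction_ge0.
    apply: le_trans (sum_antidiagonal_le (n i) P2 g0) _.
    rewrite big_split/=.
    have row (k : 'I_N.+1) : \sum_(l < N.+1) interaction T k l <= T + 4.
      rewrite big_split/= lerD ?sum_inv_sqr_dist//.
      rewrite -mulr_sumr (bigD1 k)//= eqxx big1 ?addr0 ?mulr1// => l lk.
      by rewrite eq_sym (negbTE (_ : (l : nat) != k)).
    by rewrite mulr_natl mulr2n lerD.
- apply: increment_bound_sum => i Pi; apply: increment_bound_sum => i'.
  move: Pi => /andP[P1 P2i] /andP[/andP[P1' P2i'] /eqP ne].
  exact: (quadruple_bound a0 T0 (mv _ P1) (mv _ P2i) (mv _ P1') (mv _ P2i')
    (low _ P1) (low _ P2i) (low _ P1') ne).
Qed.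

(** * High frequencies: dissipation *)

(** For modes damped at the rate [c / h] no dispersion is needed. With [E] the
    mass of the band, the crude inequality [sum x_j^2 <= (sum x_j)^2] bounds the
    fourth power of the L4 norm by [E^2 / h]; the loss of [1 / h] is recovered
    from the dissipation [E' <= - 2 (c / h) E], which makes [E^2 / h] at most the
    derivative of [- E^2 / (4 c)]. *)
Lemma high_band_bound (R : realType) (a c T : R) (N : nat) (chi : R[i])
    (P : pred 'I_N.+1) (v : 'I_N.+1 -> R -> R[i]) :
  0 < c -> 0 <= T -> fourier_root N chi ->
  (forall k, P k -> c / mesh R N <= a * dispersion R N k) ->
  (forall k, P k -> linear_mode (wave_rate a N k) (v k)) ->
  increment_bound T
    (fun t => mesh R N *
       \sum_(j < N.+1) sqmod (\sum_(k | P k) v k t * chi ^+ (k * j)) ^+ 2)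
    ((4 * c)^-1 * (\sum_(k | P k) sqmod (v k 0)) ^+ 2).
Proof.
move=> c0 T0 chiP damp mv; have h0 := mesh_gt0 R N.
pose E t := \sum_(k | P k) sqmod (v k t).
have E0 t : 0 <= E t by apply: sumr_ge0 => k _; exact: sqmod_ge0.
have [Er dE] : E s @[s --> 0^'+] --> E 0 /\
    forall t : R, 0 < t -> exists2 d, is_derive t 1 E d &
      d <= - (2 * (c / mesh R N)) * E t.
  rewrite /E; elim: (index_enum _) => [|k s [ihr ihd]].
    have -> : (fun t => \sum_(k <- [::] | P k) sqmod (v k t)) = cst 0.
      by apply/funext => t; rewrite big_nil.
    split; first by rewrite big_nil; exact: cvg_cst.
    by move=> t t0; exists 0; rewrite ?big_nil ?mulr0//; exact: is_derive_cst.
  have -> : (fun t => \sum_(k <- k :: s | P k) sqmod (v k t)) =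
      (fun t => if P k then sqmod (v k t) + \sum_(k <- s | P k) sqmod (v k t)
        else \sum_(k <- s | P k) sqmod (v k t)).
    by apply/funext => t; rewrite big_cons.
  rewrite big_cons; case Pk : (P k); last first.
    by split=> // t t0; have [d] := ihd t t0; exists d; rewrite ?big_cons ?Pk.
  have [vr dv] := linear_mode_sqmod (mv k Pk).
  split; first exact: cvgD.
  move=> t t0; have [d dd dle] := ihd t t0.
  exists (2 * complex.Re (wave_rate a N k) * sqmod (v k t) + d).
    by apply: is_deriveD => //; exact: dv.
  rewrite big_cons Pk [leRHS]mulrDr lerD// ler_wpM2r ?sqmod_ge0// Re_wave_rate.
  by have := damp k Pk; lra.
have c4 : 0 < 4 * c by rewrite mulr_gt0.
exists (fun t => - (4 * c)^-1 * E t ^+ 2); split.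
- by apply: cvgMr; rewrite !expr2; apply: cvgM.
- move=> t t0; have [d dd dle] := dE t t0.
  exists (- (4 * c)^-1 *: (E t *: d + E t *: d)).
    have := is_deriveZ (- (4 * c)^-1) (is_deriveM dd dd).
    by [].
  rewrite -[X in _ <= X]/(- (4 * c)^-1 * (E t * d + E t * d)).
  (* the step that costs a factor [1 / h] *)
  have sumsq (x : 'I_N.+1 -> R) : (forall j, 0 <= x j) ->
      \sum_j x j ^+ 2 <= (\sum_j x j) ^+ 2.
    move=> x0; rewrite [leRHS]expr2 mulr_suml; apply: ler_sum => j _.
    rewrite expr2 ler_wpM2l// (bigD1 j)//= lerDl.
    by apply: sumr_ge0 => i _.
  have := sumsq _ (fun j => sqmod_ge0 (\sum_(k | P k) v k t * chi ^+ (k * j))).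
  move=> /(ler_wpM2l (ltW h0)) /le_trans; apply.
  have := parseval P (fun k => v k t) chiP; rewrite -/(E t).
  set S := \sum_(j < _) _ => pE.
  have -> : mesh R N * S ^+ 2 = E t ^+ 2 / mesh R N.
    by rewrite -pE; field; rewrite gt_eqF.
  have := ler_wpM2l (E0 t) dle => h.
  rewrite -(ler_pM2l c4) mulNr mulrN mulVKf ?gt_eqF//.
  have -> : 4 * c * (E t ^+ 2 / mesh R N) =
    - 2 * (E t * (- (2 * (c / mesh R N)) * E t)) by field; rewrite gt_eqF.
  by lra.
- rewrite /E; have : 0 <= (4 * c)^-1 * E T ^+ 2.
    by rewrite mulr_ge0 ?invr_ge0 ?sqr_ge0// ltW.
  by rewrite /E; lra.
Qed.

(** * The Strichartz estimate *)

Lemma L4_pow4 (R : realType) (N : nat) (v : 'rV[R[i]]_N.+1) :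
  Lp_Th 4 v `^ 4 = mesh R N * \sum_(j < N.+1) sqmod (v 0 j) ^+ 2.
Proof.
rewrite /Lp_Th -powRrM mulVf// powRr1; last first.
  by rewrite mulr_ge0 ?(ltW (mesh_gt0 _ _))//;
    apply: sumr_ge0 => j _; exact: powR_ge0.
congr (_ * _); apply: eq_bigr => j _.
by rewrite (powR_mulrn 4) ?normc_ge0// sqmod_normc -exprM.
Qed.

Lemma L2_pow2 (R : realType) (N : nat) (v : 'rV[R[i]]_N.+1) :
  Lp_Th 2 v ^+ 2 = mesh R N * \sum_(j < N.+1) sqmod (v 0 j).
Proof.
rewrite -powR_mulrn ?powR_ge0// /Lp_Th -powRrM mulVf// powRr1; last first.
  by rewrite mulr_ge0 ?(ltW (mesh_gt0 _ _))//;
    apply: sumr_ge0 => j _; exact: powR_ge0.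
congr (_ * _); apply: eq_bigr => j _.
by rewrite (powR_mulrn 2) ?normc_ge0// sqmod_normc.
Qed.

(** The opposite is taken in the cyclic group of the integers modulo
    [N + 1]. *)
Lemma fourier_root_opp (R : realType) (N : nat) (chi : R[i]) (k : 'I_N.+1) :
  fourier_root N chi -> chi ^+ (- k)%R = conjc chi ^+ k.
Proof.
move=> [pr ch _]; rewrite [LHS](prim_expr_mod pr).
have e : chi ^+ k * conjc chi ^+ k = 1 by rewrite -exprMn ch expr1n.
rewrite -[LHS]mulr1 -e mulrA -exprD subnK ?(ltnW (ltn_ord k))//.
by rewrite (prim_expr_order pr) mul1r.
Qed.

Lemma dft_opp (R : realType) (N : nat) (chi : R[i]) (v : 'rV[R[i]]_N.+1)
    (k : 'I_N.+1) :
  fourier_root N chi -> dft chi v (- k)%R = dft (conjc chi) v k.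
Proof.
move=> chiP; congr (_ * _); apply: eq_bigr => j _; congr (_ * _).
by rewrite !exprM (fourier_root_opp _ (fourier_root_conj chiP)).
Qed.

Definition low_frequency (R : realType) (N : nat) (k : 'I_N.+1) : bool :=
  k%:R * unit_angle R N <= 1 / 2.

(** If neither [k] nor its opposite is low then the angle [k theta] lies between
    [1 / 2] and [2 pi - 1 / 2]. *)
Lemma high_dispersion (R : realType) (N : nat) (k : 'I_N.+1) :
  ~~ low_frequency R k -> ~~ low_frequency R (- k) ->
  2 * (1 - cos (1 / 2)) / mesh R N ^+ 2 <= dispersion R N k.
Proof.
rewrite /low_frequency -!ltNge => k1 k2.
have k0 : (0 < k)%N.
  by rewrite lt0n; apply: contraTneq k1 => ->; rewrite mul0r; lra.
have e : ((- k)%R : nat) = (N.+1 - k)%N.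
  by rewrite /= modn_small// ltn_subrL k0.
have c : cos (k%:R * unit_angle R N) <= cos (1 / 2).
  have p2 := @pi_ge2 R; apply: cos_le_away; [by apply/andP; split; lra|exact: ltW|].
  move: k2; rewrite e natrB ?(ltnW (ltn_ord k))// mulrBl.
  have -> : N.+1%:R * unit_angle R N = 2 * pi by rewrite /unit_angle mulrC divfK.
  by lra.
rewrite /dispersion ler_pM2r ?invr_gt0 ?exprn_gt0 ?mesh_gt0//.
by lra.
Qed.

(** The frequencies close to [N + 1] are the small negative ones. Reindexed by
    their opposites and read with the conjugate root of unity, they form a band
    of small nonnegative frequencies, like the first one. *)
Lemma band_decomposition (R : realType) (N : nat) (chi : R[i])
    (v : 'rV[R[i]]_N.+1) (j : 'I_N.+1) :
  fourier_root N chi ->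
  v 0 j = \sum_(k : 'I_N.+1 | low_frequency R k) dft chi v k * chi ^+ (k * j) +
    \sum_(k : 'I_N.+1 | ~~ low_frequency R (- k) && low_frequency R k)
      dft (conjc chi) v k * conjc chi ^+ (k * j) +
    \sum_(k : 'I_N.+1 | ~~ low_frequency R k && ~~ low_frequency R (- k))
      dft chi v k * chi ^+ (k * j).
Proof.
move=> chiP; rewrite (dft_inversion v j chiP).
rewrite (bigID (@low_frequency R N))/= -addrA; congr (_ + _).
rewrite (bigID (fun k : 'I_N.+1 => low_frequency R (- k)))/=; congr (_ + _).
rewrite (reindex_inj (@oppr_inj 'I_N.+1)); apply: eq_big => [k|k _].
  by rewrite opprK.
by rewrite (dft_opp _ _ chiP) exprM (fourier_root_opp _ chiP) -exprM.
Qed.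

(** Convexity of the square, once inside [sqmod] and once outside, costs
    [3 ^ 2 * 3]. *)
Lemma sqmod_sum3 (R : realType) (x y z : R[i]) :
  sqmod (x + y + z) ^+ 2 <= 27 * (sqmod x ^+ 2 + sqmod y ^+ 2 + sqmod z ^+ 2).
Proof.
have sq3 (a b c : R) : (a + b + c) ^+ 2 <= 3 * (a ^+ 2 + b ^+ 2 + c ^+ 2).
  have := sqr_ge0 (a - b); have := sqr_ge0 (b - c); have := sqr_ge0 (a - c).
  by lra.
have s3 : sqmod (x + y + z) <= 3 * (sqmod x + sqmod y + sqmod z).
  rewrite /sqmod !ReD !ImD.
  have := sq3 (complex.Re x) (complex.Re y) (complex.Re z).
  have := sq3 (complex.Im x) (complex.Im y) (complex.Im z).
  by lra.
have := sq3 (sqmod x) (sqmod y) (sqmod z).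
have : sqmod (x + y + z) ^+ 2 <= (3 * (sqmod x + sqmod y + sqmod z)) ^+ 2.
  by rewrite ler_pXn2r ?nnegrE ?sqmod_ge0//; exact: le_trans (sqmod_ge0 _) s3.
by rewrite exprMn; lra.
Qed.

Lemma inf_gt0_lower_bound (R : realType) (S : set (\bar R)) :
  (0 < ereal_inf S)%E -> exists2 c : R, 0 < c & forall x, S x -> (c%:E <= x)%E.
Proof.
move=> S0; have lb := @ereal_inf_lbound R S.
case: (ereal_inf S) S0 lb => [r||] //.
  by rewrite lte_fin => r0 lb; exists r => // x /lb.
by move=> _ lb; exists 1 => // x /lb; rewrite leye_eq => /eqP ->; rewrite leey.
Qed.

(** The constant is the sum of two low bands and a high one, for which
    [c (1 - cos (1 / 2))], up to a factor 2, is the damping that the lower bound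
    on the viscosity guarantees. *)
Lemma L4_increment_bound (R : realType) (a : R -> R) (c T : R) (N : nat)
    (phi : 'rV[R[i]]_N.+1) (u : R -> 'rV[R[i]]_N.+1) :
  0 < c -> 0 <= T -> c * mesh R N <= a (mesh R N) ->
  viscous_solution a phi u ->
  increment_bound T (fun t => mesh R N * \sum_(j < N.+1) sqmod (u t 0 j) ^+ 2)
    (27 * (4 * (T + 4) + (8 * (c * (1 - cos (1 / 2))))^-1) *
     (mesh R N * \sum_(j < N.+1) sqmod (phi 0 j)) ^+ 2).
Proof.
move=> c0 T0 ca sol; have h0 := mesh_gt0 R N.
pose chi := expi (unit_angle R N); have chiP := fourier_root_expi R N.
have chiP' := fourier_root_conj chiP.
set M := mesh R N * _.
have M0 : 0 <= M.
  by rewrite mulr_ge0 ?(ltW h0)//; apply: sumr_ge0 => j _; exact: sqmod_ge0.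
have a0 : 0 <= a (mesh R N) by apply: le_trans ca; rewrite mulr_ge0 ?ltW.
have mode z (zP : fourier_root N z) k := dft_linear_mode k zP sol.
have u0 : u 0 = phi by case: sol.
have energy z (P : pred 'I_N.+1) : fourier_root N z ->
    (\sum_(k | P k) sqmod (dft z (u 0) k)) ^+ 2 <= M ^+ 2.
  move=> zP; rewrite ler_pXn2r ?nnegrE//; last first.
    by apply: sumr_ge0 => k _; exact: sqmod_ge0.
  rewrite /M -(dft_isometry phi zP) u0 big_mkcond; apply: ler_sum => k _.
  by case: ifP => // _; exact: sqmod_ge0.
have cos0 : 0 < 1 - cos (1 / 2 : R).
  by rewrite subr_gt0; apply: cos_lt1; have := @pi_ge2 R; lra.
pose d := 2 * (c * (1 - cos (1 / 2 : R))).
have d0 : 0 < d by rewrite /d !mulr_gt0.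
have L1 := low_band_bound (P := @low_frequency R N) a0 T0 chiP (fun _ h => h)
  (fun (k : 'I_N.+1) _ => mode _ chiP k).
pose negative (k : 'I_N.+1) := ~~ low_frequency R (- k) && low_frequency R k.
have L2 := low_band_bound (P := negative) a0 T0 chiP'
  (fun _ h => proj2 (andP h)) (fun (k : 'I_N.+1) _ => mode _ chiP' k).
have damp (k : 'I_N.+1) : ~~ low_frequency R k && ~~ low_frequency R (- k) ->
    d / mesh R N <= a (mesh R N) * dispersion R N k.
  move=> /andP[k1 k2]; have hd := high_dispersion k1 k2.
  apply: le_trans (ler_pM _ _ ca hd).
  - by rewrite /d le_eqVlt; apply/orP; left; apply/eqP; field; rewrite gt_eqF.
  - by rewrite mulr_ge0 ?ltW.
  - by rewrite divr_ge0 ?sqr_ge0// mulr_ge0// ltW.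
pose high (k : 'I_N.+1) := ~~ low_frequency R k && ~~ low_frequency R (- k).
have H := high_band_bound (P := high) d0 T0 chiP damp
  (fun (k : 'I_N.+1) _ => mode _ chiP k).
have := increment_boundZ (ler0n R 27) (increment_boundD (increment_boundD L1 L2) H).
apply: increment_bound_le => [t _|].
  rewrite -!mulrDr mulrCA ler_pM2l// -!big_split mulr_sumr/=.
  apply: ler_sum => j _.
  by rewrite (band_decomposition (u t) j chiP); exact: sqmod_sum3.
rewrite -(mulrA 27); apply: ler_wpM2l => //.
have -> : (4 * (T + 4) + (8 * (c * (1 - cos (1 / 2))))^-1) * M ^+ 2 =
    2 * (T + 4) * M ^+ 2 + 2 * (T + 4) * M ^+ 2 + (4 * d)^-1 * M ^+ 2.
  by rewrite /d (mulrA 4) (_ : 4 * 2 = 8 :> R); [ring|ring].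
have T4 : 0 <= 2 * (T + 4) by rewrite mulr_ge0// addr_ge0.
by rewrite !lerD// ler_wpM2l// ?energy// invr_ge0 mulr_ge0// ltW.
Qed.

Theorem theorem4p1 (R : realType) (a : R -> R)
  (ha : (0 < ereal_inf [set (a h / h)%:E | h in mesh_sizes R])%E) :
  forall T : R, 0 < T ->
  exists C : R, 0 < C /\
    forall N : nat, admissible N ->
    forall (phi : 'rV[complex R]_N.+1) (u : R -> 'rV[complex R]_N.+1),
      viscous_solution a phi u ->
      (L4L4_Th T u <= (C * Lp_Th 2 phi)%:E)%E.
Proof.
move=> T T0; have [c c0 cle] := inf_gt0_lower_bound ha.
pose D := 27 * (4 * (T + 4) + (8 * (c * (1 - cos (1 / 2 : R))))^-1).
have D0 : 0 < D.
  rewrite /D mulr_gt0// ltr_wpDr// ?mulr_gt0// ?addr_gt0//.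
  by rewrite invr_ge0 !mulr_ge0 ?(ltW c0)// subr_ge0 cos_le1.
(* [D] bounds the fourth power of the norm for data of unit mass *)
exists (D `^ 4^-1); split; first exact: powR_gt0.
move=> N admN phi u sol; have h0 := mesh_gt0 R N.
have ca : c * mesh R N <= a (mesh R N).
  rewrite -ler_pdivlMr// -lee_fin; apply: cle; exists (mesh R N) => //.
  by exists N.
have [F [F0 dF FT]] := L4_increment_bound c0 (ltW T0) ca sol.
have rf : regular (fun t => mesh R N * \sum_(j < N.+1) sqmod (u t 0 j) ^+ 2).
  case: sol => [_ u0 du]; apply: regularM; first exact: regular_cst.
  apply: regular_sum => j; under eq_fun do rewrite expr2.
  have ru : regular (fun t => sqmod (u t 0 j)).
    by apply: regular_sqmod => // t t0; have [d ? _] := du t j t0; exists d.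
  exact: regularM.
have L0 : 0 <= Lp_Th 2 phi by exact: powR_ge0.
have int_le : (\int[lebesgue_measure]_(t in `[0%R, T]) (Lp_Th 4 (u t) `^ 4)%:E <=
    (D * Lp_Th 2 phi ^+ 4)%:E)%E.
  under eq_integral do rewrite L4_pow4.
  apply: le_trans (integral_le_increment T0 rf F0 dF) _.
  by rewrite lee_fin -[4%N]/(2 * 2)%N exprM L2_pow2.
have -> : D `^ 4^-1 * Lp_Th 2 phi = (D * Lp_Th 2 phi ^+ 4) `^ 4^-1.
  rewrite powRM ?(ltW D0) ?exprn_ge0//; congr (_ * _).
  by rewrite -(powR_mulrn 4)// -powRrM mulfV// powRr1.
rewrite /L4L4_Th -poweR_EFin; apply: gt0_ler_poweR => //.
  rewrite in_itv/= leey andbT; apply: integral_ge0 => t _.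
  by rewrite lee_fin powR_ge0.
by rewrite in_itv/= leey andbT lee_fin mulr_ge0 ?exprn_ge0// ltW.
Qed.
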